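(* Every (finite) tree is $6$-cordial. That is, for every finite tree $T$ there is a function $f:V(T)\to\mathbb{Z}_6$ such that, writing $v_a=|\{x\in V(T): f(x)=a\}|$ and $e_a=|\{xy\in E(T): f(x)+f(y)\equiv a \pmod 6\}|$ for $a\in\mathbb{Z}_6$, we have $|v_a-v_b|\le 1$ and $|e_a-e_b|\le 1$ for all $a,b\in\mathbb{Z}_6$.
   Context: For an integer $k>0$, a tree $T$ is $k$-cordial if there is a vertex labeling $f:V(T)\to\mathbb{Z}_k$ such that, with the induced edge weight $f(xy)=f(x)+f(y) \pmod k$ on each edge $xy$, each label appears on at most one more vertex than any other label, and each edge weight appears on at most one more edge than any other edge weight. *)

(* Defs.v *)
From mathcomp Require Import all_boot all_order all_algebra.
Set Implicit Arguments. Unset Strict Implicit. Unset Printing Implicit Defensive.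
Import GRing.Theory.

Definition simple_graph (V : finType) (adj : rel V) : Prop :=
  symmetric adj /\ irreflexive adj.

Definition connected_graph (V : finType) (adj : rel V) : Prop :=
  forall x y : V, connect adj x y.

Definition acyclic_graph (V : finType) (adj : rel V) : Prop :=
  forall c : seq V, uniq c -> 2 < size c -> ~~ cycle adj c.

Definition is_tree (V : finType) (adj : rel V) : Prop :=
  [/\ simple_graph adj, connected_graph adj & acyclic_graph adj].

Definition edges (V : finType) (adj : rel V) : {set {set V}} :=
  [set s : {set V} | [exists x, exists y, adj x y && (s == [set x; y])]].

Definition vcount (V : finType) (k : nat) (f : V -> 'Z_k) (a : 'Z_k) : nat :=
  #|[set x : V | f x == a]|.

Definition edge_weight (V : finType) (k : nat) (f : V -> 'Z_k) (s : {set V}) : 'Z_k :=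
  (\sum_(x in s) f x)%R.

Definition ecount (V : finType) (adj : rel V) (k : nat) (f : V -> 'Z_k) (a : 'Z_k)
  : nat :=
  #|[set s in edges adj | edge_weight f s == a]|.

(* k-cordial labeling (for k >= 2 so that 'Z_k is Z/kZ). *)
Definition cordial_labeling (V : finType) (adj : rel V) (k : nat) (f : V -> 'Z_k)
  : Prop :=
  forall a b : 'Z_k, vcount f a <= (vcount f b).+1 /\ ecount adj f a <= (ecount adj f b).+1.

Definition k_cordial (V : finType) (adj : rel V) (k : nat) : Prop :=
  exists f : V -> 'Z_k, cordial_labeling adj f.

(* Main.v *)
Require Import Defs.
From mathcomp Require Import all_boot all_order all_algebra.

(** The tree is grown from one vertex, attaching each new vertex to its unique
    neighbour in the part [R] already built.  The invariant is that the labels used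
    on [R], completed by a list [L] of distinct labels still to be used, and the edge
    weights, completed by a list [W], are both equidistributed over Z/6.  Whenever
    [#|R| = 6m], the list [L] is empty and [W] consists of a single weight [e].  Then
    six more vertices can be attached using each label once and six of the seven
    weights [e, 0, 1, ..., 5]: by a finite search this is possible for every shape of
    the attached forest, every labelling of its attachment points and every [e].
    The search fails for some forests when one starts from [6m + 1] vertices, which is
    why the induction runs through the multiples of 6.  Fewer than six new vertices
    are handled by the same search, and the first six vertices by a search in which
    the root has label 0. *)

Set Implicit Arguments.
Unset Strict Implicit.
Unset Printing Implicit Defensive.

(* [has] with a short-circuiting test: under [vm_compute], [||] evaluates both sides. *)
Fixpoint lazy_has (T : Type) (a : pred T) (s : seq T) : bool :=
  if s is x :: s' then (if a x then true else lazy_has a s') else false.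

Lemma lazy_hasE (T : Type) (a : pred T) s : lazy_has a s = has a s.
Proof. by elim: s => //= x s ->; case: (a x). Qed.

(* [code] describes the vertices to be attached, one entry each: the position in
   [env] of the label of the neighbour.  [env] holds the labels of the attachment
   points, followed by those of the new vertices as they are chosen.  [W] has at
   most one repeated weight, so [uniq W] at the end says that it was used. *)
Fixpoint solvable (L W env code : seq nat) : bool :=
  if code is p :: code' then
    lazy_has (fun l => let w := (l + nth 0 env p) %% 6 in
      if w \in W then solvable (rem l L) (rem w W) (rcons env l) code'
      else false) L
  else uniq W.

(* Ranges over the nonempty nondecreasing continuations of [acc] of length at most
   [k] with entries at least [lo]; [n] is the bound on the next entry. *)
Fixpoint all_solvable (L W env : seq nat) (k lo n : nat) (acc : seq nat) : bool :=
  if k is k'.+1 then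
    all (fun p => solvable L W env (rcons acc p) &&
                  all_solvable L W env k' p n.+1 (rcons acc p)) (iota lo (n - lo))
  else true.

Lemma all_solvable_single : all_solvable (iota 1 5) (iota 0 6) [:: 0] 5 0 1 [::].
Proof. by vm_compute. Qed.

Lemma all_solvable_step :
  all (fun e => all_solvable (iota 0 6) (e :: iota 0 6) (iota 0 6) 6 0 6 [::])
      (iota 0 6).
Proof. by vm_cast_no_check (erefl true). Qed.

(** * Attaching one vertex and its effect on the counts *)

Definition update (V : eqType) (T : Type) (f : V -> T) (x : V) (t : T) : V -> T :=
  fun z => if z == x then t else f z.

Section Growth.

Variables (V : finType) (adj : rel V).
Implicit Types (R : {set V}) (f : V -> 'Z_6) (c : V -> nat).

Definition edges_in R : {set {set V}} := [set s in edges adj | s \subset R].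

Definition vertex_count R f (a : 'Z_6) : nat := \sum_(z in R) (f z == a).
Definition weight_count R f (a : 'Z_6) : nat :=
  \sum_(s in edges_in R) (edge_weight f s == a).

Definition completes R f (L W : seq nat) (m : nat) : Prop :=
  forall a : 'Z_6, vertex_count R f a + count_mem (val a) L = m /\
                   weight_count R f a + count_mem (val a) W = m.

(** Uniqueness of the neighbour ensures that attaching [x] adds a single edge, hence a single
    weight. *)
Definition attached R (x y : V) : Prop :=
  [/\ x \notin R, y \in R, adj x y & forall z, z \in R -> adj x z -> z = y].

Hypotheses (adj_sym : symmetric adj) (adj_irr : irreflexive adj).

Lemma edges_in_attached R x y :
  attached R x y -> edges_in (x |: R) = [set x; y] |: edges_in R.
Proof.
case=> xNR yR xy uniq_y; apply/setP=> s; rewrite /edges_in /edges !inE.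
apply/andP/idP.
- case=> /existsP[u /existsP[v /andP[uv /eqP->]]].
  rewrite subUset !sub1set !inE => /andP[/orP[/eqP ux|uR] /orP[/eqP vx|vR]].
  + by rewrite ux vx adj_irr in uv.
  + by rewrite ux (uniq_y v) ?eqxx // -ux.
  + by rewrite vx (uniq_y u) ?(setUC [set y]) ?eqxx // -vx adj_sym.
  + apply/orP; right; rewrite subUset !sub1set uR vR !andbT.
    by apply/existsP; exists u; apply/existsP; exists v; rewrite uv eqxx.
- case/orP=> [/eqP->|/andP[sE sR]].
  + split; last by rewrite subUset !sub1set !inE eqxx yR orbT.
    by apply/existsP; exists x; apply/existsP; exists y; rewrite xy eqxx.
  + by split=> //; apply: subset_trans sR (subsetUr _ _).
Qed.

Lemma vertex_count_update R f x t a : x \notin R ->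
  vertex_count (x |: R) (update f x t) a = (t == a) + vertex_count R f a.
Proof.
move=> xNR; rewrite /vertex_count big_setU1 //= {1}/update eqxx; congr addn.
apply: eq_bigr => z zR; rewrite /update.
by case: (z =P x) xNR => // <-; rewrite zR.
Qed.

Lemma weight_count_update R f x y t a : attached R x y ->
  weight_count (x |: R) (update f x t) a
    = ((t + f y)%R == a) + weight_count R f a.
Proof.
move=> xy; have [xNR yR _ _] := xy.
have yx : y != x by apply: contraNneq xNR => <-.
rewrite /weight_count (edges_in_attached xy) big_setU1 /=; last first.
  by rewrite /edges_in inE subUset sub1set (negPf xNR) andbF.
congr (_ + _).
  have xy' : x \notin [set y] by rewrite inE eq_sym.
  by rewrite /edge_weight big_setU1 //= big_set1 /update eqxx (negPf yx).
apply: eq_bigr => s; rewrite inE => /andP[_ /subsetP sR].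
congr (nat_of_bool (_ == _)); apply: eq_bigr => z zs; rewrite /update.
by case: (z =P x) xNR => // <-; rewrite sR.
Qed.

Lemma completes_update R f L W m x y l :
    attached R x y -> all (gtn 6) L -> l \in L -> (l + f y) %% 6 \in W ->
    completes R f L W m ->
  completes (x |: R) (update f x (inZp l)) (rem l L) (rem ((l + f y) %% 6) W) m.
Proof.
move=> xy L6 lL wW RLW a; have [xNR _ _ _] := xy.
have l6 : l < 6 by exact: (allP L6).
rewrite vertex_count_update // (weight_count_update _ _ _ xy).
have [va wa] := RLW a; split.
- by rewrite -va (permP (perm_to_rem lL)) /= -val_eqE /= modn_small // addnCA addnA.
- rewrite -wa (permP (perm_to_rem wW)) /= -val_eqE /= modnDml /=.
  by rewrite addnCA addnA.
Qed.

(* [growth c n R code R']: [R'] arises from [R] by attaching vertices one at a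
   time; [c] numbers the vertices of [R] below [n], the new vertices are numbered
   [n], [n.+1], ..., and [code] lists the numbers of their unique neighbours. *)
Inductive growth : (V -> nat) -> nat -> {set V} -> seq nat -> {set V} -> Prop :=
| growth_nil c n R : growth c n R [::] R
| growth_cons c n R x y code R' : attached R x y ->
    growth (update c x n) n.+1 (x |: R) code R' ->
    growth c n R (c y :: code) R'.

Lemma growth_card c n R code R' : growth c n R code R' -> #|R'| = #|R| + size code.
Proof.
elim=> {c n R code R'} [c n R|c n R x y code R' [xNR _ _ _] _ ->] /=.
  by rewrite addn0.
by rewrite cardsU1 xNR addnS.
Qed.

Definition uniq_residues (s : seq nat) : bool := uniq s && all (gtn 6) s.

Lemma uniq_residues_rem x s : uniq_residues s -> uniq_residues (rem x s).
Proof.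
case/andP=> us s6; rewrite /uniq_residues rem_uniq //.
by apply/allP=> z /mem_rem /(allP s6).
Qed.

(** Replays the search along the growth: each new vertex takes one label from [L] and one weight
    from [W], and the final test of the search makes the leftover weights distinct. *)
Lemma solvable_completes c n R code R' f L W env m :
    growth c n R code R' -> solvable L W env code ->
    size env = n -> (forall z, z \in R -> c z < n) ->
    (forall z, z \in R -> nth 0 env (c z) = f z) ->
    uniq_residues L -> all (gtn 6) W -> completes R f L W m ->
  exists f' L' W', [/\ completes R' f' L' W' m, uniq_residues L', uniq_residues W',
    size L' + size code = size L & size W' + size code = size W].
Proof.
move=> g; elim: g f L W env => {c n R code R'}
  [c n R|c n R x y code R' xy _ IH] f L W env /=.
  move=> uW _ _ _ uL W6 RLW; exists f, L, W.
  by rewrite !addn0 /uniq_residues uW W6.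
rewrite lazy_hasE => /hasP[l lL]; case: ifP => // wW sol sz cn envf uL W6 RLW.
have [xNR yR _ _] := xy; rewrite envf // in wW sol.
have [_ L6] := andP uL; have l6 : l < 6 by exact: (allP L6).
have [] := IH _ _ _ _ sol _ _ _ _ _ (completes_update xy L6 lL wW RLW).
- by rewrite size_rcons sz.
- move=> z; rewrite !inE /update; case: eqP => //= _ zR.
  by apply: ltnW; rewrite ltnS cn.
- move=> z; rewrite !inE /update nth_rcons sz; case: eqP => [_ _|_ zR].
    by rewrite ltnn eqxx /= modn_small.
  by rewrite cn // envf.
- exact: uniq_residues_rem.
- by apply/allP=> z /mem_rem /(allP W6).
move=> f' [L' [W' [RLW' uL' uW' szL szW]]]; exists f', L', W'; split=> //.
  by rewrite addnS szL size_rem // prednK // -has_predT; apply/hasP; exists l.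
rewrite addnS szW size_rem // prednK // -has_predT.
by apply/hasP; exists ((l + f y) %% 6).
Qed.

(** * Growing connected parts of the tree *)

Definition connected_in R : Prop :=
  {in R &, forall u v, connect [rel a b | [&& adj a b, a \in R & b \in R]] u v}.

Lemma connected_in_attached R x y :
  attached R x y -> connected_in R -> connected_in (x |: R).
Proof.
case=> xNR yR xy _ cR.
set e := [rel a b | [&& adj a b, a \in x |: R & b \in x |: R]].
have e_sym : connect_sym e.
  by apply: sym_connect_sym => a b /=; rewrite adj_sym (andbC (a \in _)).
have to_y u : u \in x |: R -> connect e u y.
  case/setU1P=> [->|uR].
    by apply: connect1; rewrite /= xy !inE eqxx yR orbT.
  apply: connect_sub (cR u y uR yR) => a b /and3P[ab aR bR].
  by apply: connect1; rewrite /= ab !inE aR bR !orbT.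
move=> u v uR vR; apply: connect_trans (to_y u uR) _.
by rewrite e_sym; apply: to_y.
Qed.

Hypotheses (adj_conn : connected_graph adj) (adj_acyc : acyclic_graph adj).

(** A second neighbour [z] of [x] in [R] would close a cycle through [x] and a path inside [R] from
    [y] to [z]. *)
Lemma attached_of_adj R x y :
  connected_in R -> x \notin R -> y \in R -> adj x y -> attached R x y.
Proof.
move=> cR xNR yR xy; split=> // z zR xz; apply/eqP; apply: contraT => zy.
have /connectP[p pp pz] := cR y z yR zR.
case/shortenP: pp pz => q pq uq _ qz.
have qR : {subset y :: q <= R}.
  move=> v; rewrite inE => /orP[/eqP->//|].
  elim: q (y) pq {uq qz} => //= a q IH b /andP[/and3P[_ _ aR] pq].
  by rewrite inE => /orP[/eqP->//|/(IH _ pq)].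
have q0 : 0 < size q by case: q qz {pq uq qR} zy => //= ->; rewrite eqxx.
have uc : uniq (x :: y :: q) by rewrite cons_uniq uq andbT; apply: contra xNR => /qR.
have sc : 2 < size (x :: y :: q) by [].
rewrite -(negPf (adj_acyc uc sc)) /= xy rcons_path -qz adj_sym xz andbT.
by apply: sub_path pq => a b /and3P[].
Qed.

Lemma exists_boundary R : R != set0 -> R != setT ->
  exists x y, [/\ x \notin R, y \in R & adj x y].
Proof.
move=> /set0Pn[r rR] RT.
have /subsetPn[v _ vNR] : ~~ (setT \subset R) by rewrite subTset.
have /connectP[p pp pv] := adj_conn r v.
elim: p r rR pp pv => [|a p IH] r rR /=; first by move=> _ vr; rewrite vr rR in vNR.
case/andP=> ra pa pv; case: (boolP (a \in R)) => aR; first exact: IH pv.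
by exists a, r; rewrite adj_sym.
Qed.

(* Always attaching a vertex whose neighbour has the least number makes the code
   nondecreasing, so only such codes need to be searched. *)
Lemma exists_growth L W env k lo n acc c R :
    all_solvable L W env k lo n acc -> R != set0 -> connected_in R ->
    (forall z, z \in R -> c z < n) ->
    (forall x y, x \notin R -> y \in R -> adj x y -> lo <= c y) ->
  exists code R', [/\ growth c n R code R', connected_in R',
    R' = setT \/ size code = k & code = [::] \/ solvable L W env (acc ++ code)].
Proof.
elim: k lo n acc c R => [|k IH] lo n acc c R /=.
  by move=> _ _ cR _ _; exists [::], R; split=> //; [left| right|left]; constructor.
move=> /allP sol R0 cR cn clo.
have [RE|RT] := eqVneq R setT.
  by exists [::], R; split; [apply: growth_nil| |left|left].
have [x0 [y0 [x0N y0R xy0]]] := exists_boundary R0 RT.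
pose P := [pred u : V * V | [&& u.1 \notin R, u.2 \in R & adj u.1 u.2]].
have P0 : P (x0, y0) by rewrite /= x0N y0R.
case: (arg_minnP (fun u : V * V => c u.2) P0) => -[x y] /and3P[/= xNR yR xy] cmin.
have xyR := attached_of_adj cR xNR yR xy.
have : c y \in iota lo (n - lo).
  by rewrite mem_iota (clo x y) //= subnKC ?cn // (leq_trans (clo x y _ _ _)) // ltnW ?cn.
move=> /sol /andP[sol1 /(IH _ _ _ (update c x n) (x |: R))].
case.
- by apply/set0Pn; exists x; rewrite !inE eqxx.
- exact: connected_in_attached xyR cR.
- move=> z; rewrite !inE /update; case: eqP => //= _ zR.
  by apply: ltnW; rewrite ltnS cn.
(* A boundary edge of [x |: R] either ends at [x], numbered [n > c y], or was a boundary edge of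
   [R], where [c y] is least. *)
- move=> u v; rewrite !inE negb_or /update => /andP[ux uR] /orP[/eqP-> _|vR uv].
    by rewrite eqxx ltnW ?cn.
  case: eqP => [_|_]; first by rewrite ltnW ?cn.
  by apply: (cmin (u, v)); rewrite /= uR vR.
move=> code [R' [g cR' szk solc]]; exists (c y :: code), R'; split=> //.
- exact: growth_cons g.
- by case: szk => [|<-]; [left|right].
- right; case: solc => [->|]; first by rewrite cats1.
  by rewrite cat_rcons.
Qed.

(** * Induction by blocks of six vertices *)

Definition labellable R : Prop := exists f L W m,
  [/\ completes R f L W m, uniq_residues L & uniq_residues W].

Definition exactly_labellable R : Prop :=
  exists f e m, e < 6 /\ completes R f [::] [:: e] m.

(** A tree has one edge fewer than vertices, hence the extra entry of [W]. Growth stops early only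
    at the whole tree; otherwise it uses up [L] and leaves one weight. *)
Lemma extend L W env c n f m R :
    all_solvable L W env (size L) 0 n [::] -> 0 < size L -> size W = (size L).+1 ->
    size env = n -> (forall z, z \in R -> c z < n) ->
    (forall z, z \in R -> nth 0 env (c z) = f z) ->
    uniq_residues L -> all (gtn 6) W -> completes R f L W m ->
    R != set0 -> connected_in R ->
  R = setT \/ exists R', [/\ #|R| < #|R'|, connected_in R' &
    if R' == setT then labellable R' else exactly_labellable R'].
Proof.
move=> sol L0 szW sz cn envf uL W6 RLW R0 cR.
have [->|RT] := eqVneq R setT; [by left | right].
have [code [R' [g cR' szk solc]]] :=
  exists_growth sol R0 cR cn (fun _ _ _ _ _ => leq0n _).
have code0 : 0 < size code.
  rewrite lt0n; apply: contra RT => /eqP sz0; have := growth_card g.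
  case: szk => [->|szk]; last by rewrite -szk sz0 in L0.
  by rewrite sz0 addn0 => card_R; rewrite eqEcard subsetT card_R leqnn.
exists R'; split=> //; first by rewrite (growth_card g) -addn1 leq_add2l.
have {}solc : solvable L W env code.
  by case: solc => // codeE; rewrite codeE in code0.
have [f' [L' [W' [RLW' uL' uW' szL' szW']]]] :=
  solvable_completes g solc sz cn envf uL W6 RLW.
case: eqVneq => [_|R'T]; first by exists f', L', W', m.
case: szk => [R'E|szk]; first by rewrite R'E eqxx in R'T.
have /size0nil L'0 : size L' = 0 by apply: (@addIn (size code)); rewrite szL' szk.
have : size W' = 1 by apply: (@addIn (size code)); rewrite szW' szW szk.
case: W' RLW' uW' {szW'} => [|e [|? ?]] //= RLW' uW' _; rewrite L'0 in RLW'.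
exists f', e, m; split=> //.
by case/andP: uW' => _ /=; rewrite andbT.
Qed.

Lemma count_iota06 (a : 'Z_6) : count_mem (val a) (iota 0 6) = 1.
Proof. by rewrite count_uniq_mem ?iota_uniq // mem_iota (ltn_ord a). Qed.

Lemma labellable_single r : connected_in [set r] /\
  completes [set r] (fun=> 0%R) (iota 1 5) (iota 0 6) 1.
Proof.
split=> [u v /set1P-> /set1P->|a]; first exact: connect0.
rewrite count_iota06 /vertex_count big_set1; split.
  rewrite count_uniq_mem ?iota_uniq // mem_iota -val_eqE /=.
  by have := ltn_ord a; rewrite /Zp_trunc /=; case: (val a) => [|n] //= ->.
rewrite /weight_count big1 // => s; rewrite /edges_in /edges !inE.
case/andP=> /existsP[u /existsP[v /andP[uv /eqP->]]].
rewrite subUset !sub1set !inE => /andP[/eqP ur /eqP vr].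
by rewrite ur vr adj_irr in uv.
Qed.

Lemma labellable_setT (r : V) : labellable [set: V].
Proof.
have [c1 l1] := labellable_single r.
have r0 : [set r] != set0 by apply/set0Pn; exists r; rewrite inE.
suff grow j : labellable [set: V] \/
    exists R, [/\ j < #|R|, connected_in R & exactly_labellable R].
  by case: (grow #|V|) => // -[R []]; rewrite ltnNge max_card.
elim: j => [|j [H|[R [jR cR [f [e [m [e6 Rem]]]]]]]]; [|by left|].
- have [<-|[R [cardR cR]]] := @extend (iota 1 5) (iota 0 6) [:: 0] (fun=> 0) 1
    (fun=> 0%R) 1 [set r] all_solvable_single isT erefl erefl
    (fun _ _ => isT) (fun _ _ => erefl) isT isT l1 r0 c1.
    by left; exists (fun=> 0%R), (iota 1 5), (iota 0 6), 1.
  case: eqP => [-> ? |_ ?]; [by left|right].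
  by exists R; split=> //; apply: leq_ltn_trans cardR.
(* A further round of all labels and weights raises the target by one and makes [e] the repeated
   weight. *)
have Rem' : completes R f (iota 0 6) (e :: iota 0 6) m.+1.
  move=> a; have [va wa] := Rem a.
  rewrite -cat1s count_cat count_iota06.
  by split; [rewrite addn1 -va addn0|rewrite addnA addn1 wa].
have R0 : R != set0 by rewrite -card_gt0; apply: leq_ltn_trans jR.
have sol := allP all_solvable_step e; rewrite mem_iota in sol.
have eW6 : all (gtn 6) (e :: iota 0 6) by rewrite /= e6.
(* Each vertex of [R] is numbered by its own label, since the search needs nothing else about an
   attachment point. *)
have envf z : z \in R -> nth 0 (iota 0 6) (f z) = f z.
  by rewrite nth_iota // (ltn_ord (f z)).
have [RT|[R' [cardR cR']]] := extend (sol e6) isT erefl erefl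
  (fun z _ => ltn_ord (f z)) envf isT eW6 Rem' R0 cR.
  by left; rewrite -RT; exists f, [::], [:: e], m.
case: eqP => [-> ? |_ ?]; [by left|right].
by exists R'; split=> //; apply: leq_ltn_trans cardR.
Qed.

(** As [L] and [W] have no repetitions, every count is [m] or [m - 1]. *)
Lemma labellable_k_cordial : labellable [set: V] -> k_cordial adj 6.
Proof.
case=> f [L [W [m [RLW /andP[uL _] /andP[uW _]]]]]; exists f => a b.
have vE d : vcount f d = vertex_count setT f d.
  rewrite /vcount /vertex_count -sum1dep_card big_mkcond.
  by apply: eq_big => [z|z _]; rewrite ?inE //; case: eqP.
have wE d : ecount adj f d = weight_count setT f d.
  rewrite /ecount /weight_count -sum1dep_card big_mkcondr.
  apply: eq_big => [z|z _]; last by case: eqP.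
  by rewrite /edges_in !inE subsetT andbT.
have near (x y : nat) (p q : bool) : x + p = m -> y + q = m -> x <= y.+1.
  move=> xm ym; apply: leq_trans (leq_addr p x) _.
  by rewrite xm -ym -[y.+1]addn1 leq_add2l leq_b1.
have [va wa] := RLW a; have [vb wb] := RLW b.
rewrite !vE !wE; move: va wa vb wb; rewrite !count_uniq_mem // => va wa vb wb.
by split; [apply: near va vb|apply: near wa wb].
Qed.

End Growth.

Theorem mainTheorem1 (V : finType) (adj : rel V) :
  is_tree adj -> k_cordial adj 6.
Proof.
case=> -[adj_sym adj_irr] adj_conn adj_acyc.
case: (pickP V) => [r _|V0].
  exact: labellable_k_cordial (labellable_setT _ _ _ _ r).
exists (fun=> 0%R) => a b.
have no_edge : edges adj = set0.
  by apply/setP=> s; rewrite !inE; apply/existsP=> -[x]; have := V0 x.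
rewrite /vcount /ecount no_edge.
split; first by rewrite (leq_trans (max_card _)) // (eq_card0 V0).
by rewrite [X in X <= _]eq_card0 // => s; rewrite !inE.
Qed.
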